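(* Let $\Omega^\star\in\mathcal O_E$ be locally optimal for the problem $\min_{\Omega\in\mathcal O_E}\mathcal J(\Omega,y_\Omega)$, i.e. there is $R>0$ such that $\mathcal J(\Omega^\star,y_{\Omega^\star})\le\mathcal J(\Omega,y_\Omega)$ for all $\Omega\in\mathcal O_E$ with $d_{\mathcal H}(\partial\Omega^\star,\partial\Omega)\le R$. Then for every $g^\star\in\mathcal F_E$ with $\Omega_{g^\star}=\Omega^\star$ there exists $r>0$ such that $j(g^\star)\le j(g)$ for all $g\in\mathcal F_E$ satisfying: $\|g-g^\star\|_{C^1(\bar D)}\le r$; $\Omega_g\in\mathcal O$; $\{g=0\}\cap C^\star\ne\emptyset$ for every connected component $C^\star$ of $\{g^\star=0\}$; and $\{g^\star=0\}\cap C\neq\emptyset$ for every connected component $C$ of $\{g=0\}$.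
   Context: $D\subset\mathbb R^2$ is a fixed bounded domain and $E\subset\subset D$ is a non-empty subdomain. $p>2$, $f\in L^p(D)$. $\beta:\mathbb R\to\mathbb R$ is monotone increasing, Lipschitz on each interval $[-M,M]$, and directionally differentiable at every point. $\mathcal F:=\{g\in C^2(\bar D): |\nabla g(x)|+|g(x)|>0\ \forall x\in D,\ g(x)>0\ \forall x\in\partial D,\ g^{-1}((-\infty,0])\ne\emptyset\}$; $\Omega_g:=\{x\in D:g(x)<0\}$; $\{g=0\}:=\{x\in D:g(x)=0\}=\partial\Omega_g$ for $g\in\mathcal F$, a finite union of disjoint closed $C^2$ curves without self-intersections (its components). $\mathcal F_E:=\{g\in\mathcal F:g<0\text{ in }\bar E\}$. $\mathcal O:=\{\Omega\subset D:\Omega\text{ is a non-empty }C^2\text{ domain},\ \partial\Omega\cap\partial D=\emptyset\}$ and $\mathcal O_E:=\{\Omega\in\mathcal O:E\subset\subset\Omega\}$. For a subset $\Omega$ of $D$ of class $C^2$, $y_\Omega\in H^1_0(\Omega)$ is the solution of $-\Delta y_\Omega+\beta(y_\Omega)=f$ in $\Omega$, $y_\Omega=0$ on $\partial\Omega$, extended by zero to $D$; $y_g:=y_{\Omega_g}$. $\mathcal J:\mathcal C_2\times H_0^1(D)\to\mathbb R$ is a given functional, where $\mathcal C_2$ is the set of all subsets of $D$ of class $C^2$, and $j(g):=\mathcal J(\Omega_g,y_g)$. $d_{\mathcal H}$ is the Hausdorff–Pompeiu distance between compact sets. *)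

(* Defs.v *)
From HB Require Import structures.
From mathcomp Require Import all_boot all_order all_algebra.
From mathcomp Require Import all_classical all_reals all_analysis measurable_realfun.
Set Implicit Arguments.
Unset Strict Implicit.
Unset Printing Implicit Defensive.
Import Order.TTheory GRing.Theory Num.Theory.
Import numFieldNormedType.Exports.
Local Open Scope classical_set_scope.
Local Open Scope ring_scope.

Notation plane R := (R * R)%type.

(* The library norm on [R * R] is the max norm (with the same topology); metric
   notions below use the Euclidean norm instead. *)
Definition enorm (R : realType) (x : plane R) : R :=
  Num.sqrt (x.1 ^+ 2 + x.2 ^+ 2).

Definition bdry (T : topologicalType) (A : set T) : set T :=
  closure A `\` interior A.

Definition domain (T : topologicalType) (A : set T) : Prop :=
  [/\ open A, connected A & A !=set0].

Definition compactly_included (T : topologicalType) (A B : set T) : Prop :=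
  compact (closure A) /\ closure A `<=` B.

Definition component (T : topologicalType) (A C : set T) : Prop :=
  exists2 x, A x & C = connected_component A x.

Definition edist_set (R : realType) (a : plane R) (B : set (plane R)) : \bar R :=
  ereal_inf [set (enorm (a - b))%:E | b in B].

Definition hausdorff_dist (R : realType) (A B : set (plane R)) : \bar R :=
  maxe (ereal_sup [set edist_set a B | a in A])
       (ereal_sup [set edist_set b A | b in B]).

Definition dx (R : realType) (f : plane R -> R) (x : plane R) : R :=
  'D_((1, 0) : plane R) f x.

Definition dy (R : realType) (f : plane R -> R) (x : plane R) : R :=
  'D_((0, 1) : plane R) f x.

Definition grad_norm (R : realType) (f : plane R -> R) (x : plane R) : R :=
  enorm (dx f x, dy f x).

(* C^k(D) for an open set D *)
Fixpoint Ck (R : realType) (k : nat) (D : set (plane R)) (f : plane R -> R) : Prop :=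
  match k with
  | 0 => {within D, continuous f}
  | k'.+1 => [/\ forall x, D x -> differentiable f x,
                 Ck k' D (dx f) & Ck k' D (dy f)]
  end.

(* all partial derivatives of order at most k extend continuously to the
   closure of D *)
Fixpoint partials_extend (R : realType) (k : nat) (D : set (plane R))
    (f : plane R -> R) : Prop :=
  (exists h : plane R -> R,
     {within closure D, continuous h} /\ forall x, D x -> h x = f x) /\
  match k with
  | 0 => True
  | k'.+1 => partials_extend k' D (dx f) /\ partials_extend k' D (dy f)
  end.

(* C^k(closure D): an element is represented by any [g : plane R -> R] that
   agrees with it on [closure D]; the values of [g] elsewhere are irrelevant. *)
Definition Ck_closure (R : realType) (k : nat) (D : set (plane R))
    (g : plane R -> R) : Prop :=
  [/\ {within closure D, continuous g}, Ck k D g & partials_extend k D g].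

(* The norm of C^1(closure D). The supremum of the gradient over D is that of
   its continuous extension over the closure. *)
Definition C1_norm (R : realType) (D : set (plane R)) (h : plane R -> R) : \bar R :=
  (ereal_sup [set (`|h x|)%:E | x in closure D] +
   ereal_sup [set (grad_norm h x)%:E | x in D])%E.

Definition C2_real (R : realType) (gam : R -> R) : Prop :=
  [/\ forall t, derivable gam t 1,
      forall t, derivable (derive1 gam) t 1 &
      continuous (derive1 (derive1 gam))].

(* Near each boundary point, and after a rotation of the axes (the new axes are
   directed by (e.2, - e.1) and by e), the open set Om is the strict epigraph of
   a C^2 function. *)
Definition class_C2 (R : realType) (Om : set (plane R)) : Prop :=
  open Om /\
  forall x0, bdry Om x0 ->
  exists (rho : R) (e : plane R) (gam : R -> R),
    [/\ 0 < rho, enorm e = 1, C2_real gam &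
        forall x, enorm (x - x0) < rho ->
          (Om x <-> gam (x.1 * e.2 - x.2 * e.1) < x.1 * e.1 + x.2 * e.2)].

Definition calO (R : realType) (D Om : set (plane R)) : Prop :=
  [/\ Om `<=` D, domain Om, class_C2 Om & bdry Om `&` bdry D = set0].

Definition calO_E (R : realType) (D E Om : set (plane R)) : Prop :=
  calO D Om /\ compactly_included E Om.

Definition calF (R : realType) (D : set (plane R)) (g : plane R -> R) : Prop :=
  [/\ Ck_closure 2 D g,
      forall x, D x -> 0 < grad_norm g x + `|g x|,
      forall x, bdry D x -> 0 < g x &
      exists2 x, closure D x & g x <= 0].

Definition calF_E (R : realType) (D E : set (plane R)) (g : plane R -> R) : Prop :=
  calF D g /\ forall x, closure E x -> g x < 0.

Definition sublevel (R : realType) (D : set (plane R)) (g : plane R -> R) :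
  set (plane R) := [set x | D x /\ g x < 0].

Definition zeroset (R : realType) (D : set (plane R)) (g : plane R -> R) :
  set (plane R) := [set x | D x /\ g x = 0].

Notation mplane R := (measurableTypeR R * measurableTypeR R)%type.

Definition area (R : realType) : {measure set (mplane R) -> \bar R} :=
  (@lebesgue_measure R \x @lebesgue_measure R)%E.

Definition test_fun (R : realType) (Om : set (plane R)) (phi : plane R -> R) : Prop :=
  (forall k, Ck k setT phi) /\ compactly_included [set x | phi x != 0] Om.

Definition L2_cvg (R : realType) (u_ : nat -> plane R -> R) (u : plane R -> R) : Prop :=
  (fun n => 'N[area R]_(2%:E)[EFin \o (u_ n \- u)%R]%E) @ \oo --> 0%E.

(* [u] lies in H^1_0(Om), defined as the closure of the test functions of Om in
   the H^1 norm, and has weak gradient (v1, v2). Integrals being over the whole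
   plane, u vanishes a.e. outside Om: elements of H^1_0(Om) come extended by
   zero. *)
Definition H10_grad (R : realType) (Om : set (plane R)) (u v1 v2 : plane R -> R) : Prop :=
  [/\ u \in Lfun (area R) 2%:E, v1 \in Lfun (area R) 2%:E,
      v2 \in Lfun (area R) 2%:E &
      exists phi : nat -> plane R -> R,
        [/\ forall n, test_fun Om (phi n), L2_cvg phi u,
            L2_cvg (fun n => dx (phi n)) v1 & L2_cvg (fun n => dy (phi n)) v2]].

Notation ae_class R := {mfun_ (area R), (mplane R) >-> (measurableTypeR R)}%type.

Definition H10 (R : realType) (Om : set (plane R)) : set (ae_class R) :=
  [set u | exists v1 v2, H10_grad Om u v1 v2].

Definition weak_solution (R : realType) (f : plane R -> R) (beta : R -> R)
    (Om : set (plane R)) (u : plane R -> R) : Prop :=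
  exists v1 v2, H10_grad Om u v1 v2 /\
  forall w z1 z2, H10_grad Om w z1 z2 ->
    (area R).-integrable Om (fun x => (beta (u x) * w x)%:E) /\
    \int[area R]_(x in Om) (v1 x * z1 x + v2 x * z2 x) +
    \int[area R]_(x in Om) (beta (u x) * w x) =
    \int[area R]_(x in Om) (f x * w x).

Local Open Scope quotient_scope.

Lemma dx_cst0 (R : realType) : dx (fun=> 0 : R) = fun=> 0.
Proof. by apply/funext => x; rewrite /dx -[fun=> 0]/(cst 0) derive_cst. Qed.

Lemma dy_cst0 (R : realType) : dy (fun=> 0 : R) = fun=> 0.
Proof. by apply/funext => x; rewrite /dy -[fun=> 0]/(cst 0) derive_cst. Qed.

Lemma test_fun0 (R : realType) (Om : set (plane R)) : test_fun Om (fun=> 0).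
Proof.
split=> [k|].
  elim: k => [|k IHk] /=; first exact/continuous_subspaceT/cst_continuous.
  by rewrite dx_cst0 dy_cst0; split=> // x _; exact: differentiable_cst.
suff -> : [set x : plane R | (0 : R) != 0] = set0.
  by rewrite /compactly_included closure0; split=> //; exact: compact0.
by apply/seteqP; split=> x //=; rewrite eqxx.
Qed.

Lemma Lnorm2_ae0 (R : realType) (u : mplane R -> R) :
  measurable_fun setT u -> u = cst 0 %[ae area R] ->
  'N[area R]_(2%:E)[EFin \o u]%E = 0%E.
Proof.
move=> mu u0; rewrite -(@Lnorm0 _ _ _ (area R) 2%:E)//.
rewrite unlock /Lnorm; congr (_ `^ _)%E.
apply: ae_eq_integral => //.
- apply: (measurableT_comp (measurable_poweR _)) => //.
  by do 2 apply: measurableT_comp => //.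
- apply: (@filterS _ _ (ae_filter_ringOfSetsType (area R))) u0 => x /= ux _.
  by rewrite ux.
Qed.

Lemma Lfun2_ae0 (R : realType) (u : mplane R -> R) :
  measurable_fun setT u -> u = cst 0 %[ae area R] -> u \in Lfun (area R) 2%:E.
Proof.
move=> mu u0; apply/andP; split; first by rewrite inE.
by rewrite inE /= /finite_norm Lnorm2_ae0.
Qed.

Definition ae_zero (R : realType) : ae_class R := \pi_(ae_class R) (cst 0).

Lemma ae_zeroE (R : realType) : (ae_zero R : mplane R -> R) = cst 0 %[ae area R].
Proof.
apply/asboolP; rewrite /aqEqMfun_to_fun.
by have /eqmodP := reprK (ae_zero R).
Qed.

Lemma H10_ae_zero (R : realType) (Om : set (plane R)) : H10 Om (ae_zero R).
Proof.
have mz : measurable_fun setT (ae_zero R : mplane R -> R).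
  exact: (@measurable_funPT _ _ _ _ (repr (ae_zero R))).
have z0 := @ae_zeroE R.
exists (cst 0), (cst 0); split.
- exact: Lfun2_ae0.
- by apply: Lfun2_ae0 => //; exact: ae_eq_refl.
- by apply: Lfun2_ae0 => //; exact: ae_eq_refl.
exists (fun=> fun=> 0).
have cvg0 (u : mplane R -> R) : measurable_fun setT u -> u = cst 0 %[ae area R] ->
    L2_cvg (fun=> fun=> 0) u.
  move=> mu u0; apply: cvg_near_cst; apply: nearW => n; apply: Lnorm2_ae0.
    by apply: measurable_funB.
  apply: (@filterS _ _ (ae_filter_ringOfSetsType (area R))) u0 => x /= ux _.
  by rewrite ux ?subrr.
split; first by move=> _; exact: test_fun0.
- exact: cvg0.
- rewrite dx_cst0. apply: cvg0 => //; exact: ae_eq_refl.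
- rewrite dy_cst0. apply: cvg0 => //; exact: ae_eq_refl.
Qed.

Definition H10_0 (R : realType) (D : set (plane R)) : H10 D :=
  exist _ (ae_zero R) (mem_set (@H10_ae_zero R D)).

(* The solution y_Om of - Laplacian y + beta y = f in Om with y = 0 on the
   boundary of Om, as an element of H^1_0(D). Since beta is monotone a weak
   solution is unique; the default [H10_0 D] would only matter if none existed. *)
Definition state (R : realType) (D : set (plane R)) (f : plane R -> R)
    (beta : R -> R) (Om : set (plane R)) : H10 D :=
  xget (H10_0 D) [set y | weak_solution f beta Om (val y : ae_class R)].

Definition lipschitz_on_bounded (R : realType) (beta : R -> R) : Prop :=
  forall M : R, [lipschitz beta x | x in [set` `[- M, M]]].

Definition directionally_differentiable (R : realType) (beta : R -> R) : Prop :=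
  forall x h : R, cvg ((fun t => t^-1 * (beta (x + t * h) - beta x)) @ 0^'+).

(* The functional J is defined on pairs (set of class C^2, element of H^1_0(D)).
   It is total in its first argument here: its values at sets that are not of
   class C^2 play no role. *)
Definition locally_optimal (R : realType) (D E : set (plane R))
    (f : plane R -> R) (beta : R -> R) (J : set (plane R) -> H10 D -> R)
    (Oms : set (plane R)) : Prop :=
  exists2 rho : R, 0 < rho &
    forall Om, calO_E D E Om ->
      (hausdorff_dist (bdry Oms) (bdry Om) <= rho%:E)%E ->
      J Oms (state D f beta Oms) <= J Om (state D f beta Om).

Definition j_fun (R : realType) (D : set (plane R)) (f : plane R -> R)
    (beta : R -> R) (J : set (plane R) -> H10 D -> R) (g : plane R -> R) : R :=
  J (sublevel D g) (state D f beta (sublevel D g)).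

(* Main.v *)
Require Import Defs.
From mathcomp Require Import all_boot all_order all_algebra.
From mathcomp Require Import all_classical all_reals all_analysis measurable_realfun.
From mathcomp Require Import lra.
Import Order.TTheory GRing.Theory Num.Theory.
Import numFieldNormedType.Exports.
Local Open Scope classical_set_scope.
Local Open Scope ring_scope.

(** Local optimality of [Oms] is a statement about the Hausdorff distance of
    boundaries, so it suffices that a function [g] which is uniformly close to
    [gs] has the boundary of its sublevel set within a prescribed distance
    [rho] of that of [gs]. For [g] in [calF] the gradient does not vanish on
    the zero set, which is therefore exactly the boundary of the sublevel set
    ([zeroset_bdry]). The two one-sided estimates then both follow from the
    compactness of the closure of [D].

    - A zero of [g] is a point where [gs] is small, and small values of [gs]
      occur only near zeros of [gs], since [`|gs|] is bounded away from zero at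
      a distance from them ([almost_zero_near_zeroset]).
    - At a zero of [gs] the gradient is nonzero, hence [gs] changes sign along
      a short segment through it; the strict signs at the two ends survive a
      small uniform perturbation, and the intermediate value theorem gives a
      zero of [g] on the segment ([zero_persists]). Compactness makes the size
      of the perturbation uniform in the zero of [gs]
      ([zeroset_near_perturbed_zeroset]). *)

(** * Euclidean norm, compactness, Hausdorff distance *)

Lemma enorm_ge0 (R : realType) (x : plane R) : 0 <= enorm x.
Proof. exact: sqrtr_ge0. Qed.

Lemma enorm_near0 (R : realType) (e : R) : 0 < e ->
  \forall u \near (0 : plane R), enorm u < e.
Proof.
move=> e0.
have c : @enorm R u @[u --> (0 : plane R)] --> (0 : R).
  have -> : (0 : R) = enorm (0 : plane R) by rewrite /enorm/= expr0n/= addr0 sqrtr0.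
  have sq_cvg : (fun u : plane R => u.1 ^+ 2 + u.2 ^+ 2) @ (0 : plane R) -->
     ((0 : plane R).1 ^+ 2 + (0 : plane R).2 ^+ 2).
    by apply: cvgD; apply: (continuous_cvg _ (@exprn_continuous _ 2 _));
     [exact: cvg_fst|exact: cvg_snd].
  exact: (continuous_cvg _ (@sqrt_continuous R _) sq_cvg).
by apply: (cvgr_lt _ c).
Qed.

Lemma enorm_near (R : realType) (x : plane R) (e : R) : 0 < e ->
  \forall y \near x, enorm (y - x) < e.
Proof.
move=> /enorm_near0 e0.
have c : (fun y => y - x) @ x --> (0 : plane R).
  by rewrite -(subrr x); apply: cvgB; [exact: cvg_id|exact: cvg_cst].
exact: (c _ e0).
Qed.

Lemma bounded_closure_compact (R : realType) (A : set (plane R)) :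
  bounded_set A -> compact (closure A).
Proof.
move=> [M [_ MA]].
have cK : compact (`[- (M + 1), M + 1]%classic `*` `[- (M + 1), M + 1]%classic
    : set (plane R)).
  by apply: compact_setX; exact: segment_compact.
apply: (subclosed_compact _ cK); first exact: closed_closure.
have clK := compact_closed (@norm_hausdorff _ _) cK.
rewrite closureE; apply: smallest_sub => //.
move=> x /(MA (M + 1) _); rewrite ltrDl ltr01 => /(_ isT).
rewrite /= prod_normE /= ge_max => /andP[x1 x2].
by rewrite !in_itv/= -!ler_norml.
Qed.

Lemma hausdorff_dist_le (R : realType) (A B : set (plane R)) (e : R) :
  (forall a, A a -> exists2 b, B b & enorm (a - b) <= e) ->
  (forall b, B b -> exists2 a, A a & enorm (b - a) <= e) ->
  (hausdorff_dist A B <= e%:E)%E.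
Proof.
move=> AB BA; rewrite /hausdorff_dist ge_max; apply/andP; split;
  apply: ge_ereal_sup => _ [x xA <-].
  have [y yB le] := AB _ xA; apply: (@le_trans _ _ (enorm (x - y))%:E).
    by apply: ereal_inf_lbound; exists y.
  by rewrite lee_fin.
have [y yB le] := BA _ xA; apply: (@le_trans _ _ (enorm (x - y))%:E).
  by apply: ereal_inf_lbound; exists y.
by rewrite lee_fin.
Qed.

(** The gradient part of the norm is a supremum over [D], which is [-oo] for
    empty [D] and nonnegative otherwise. *)
Lemma C1_norm_ub (R : realType) (D : set (plane R)) (h : plane R -> R) (r : R) x :
  D !=set0 -> (C1_norm D h <= r%:E)%E -> closure D x -> `|h x| <= r.
Proof.
move=> [x0 Dx0] hr clx; rewrite -lee_fin; apply: le_trans hr.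
apply: (@le_trans _ _ (ereal_sup [set (`|h x|)%:E | x in closure D])).
  by apply: ereal_sup_ubound; exists x.
rewrite /C1_norm leeDl//; apply: (@le_trans _ _ (grad_norm h x0)%:E).
  by rewrite lee_fin enorm_ge0.
by apply: ereal_sup_ubound; exists x0.
Qed.

(** * Sign changes and zeros *)

(** Some partial derivative [l], in a basis direction [u], is nonzero; along
    [l *: u] the derivative is [l ^+ 2]. *)
Lemma ascent_direction (R : realType) (f : plane R -> R) (x : plane R) :
  differentiable f x -> 0 < grad_norm f x -> exists v, 0 < 'D_v f x.
Proof.
move=> df gf.
have [u Du] : exists u, 'D_u f x != 0.
  have [dx0|] := eqVneq (dx f x) 0; last by exists (1, 0).
  have [dy0|] := eqVneq (dy f x) 0; last by exists (0, 1).
  by move: gf; rewrite /grad_norm /enorm dx0 dy0/= expr0n/= addr0 sqrtr0 ltxx.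
exists ('D_u f x *: u); rewrite [ltRHS]deriveE// linearZ/= -deriveE//.
by rewrite /GRing.scale/= -expr2 exprn_even_gt0.
Qed.

Lemma line_cvg (R : realType) (x v : plane R) :
  (x + h *: v) @[h --> (0 : R)] --> x.
Proof.
rewrite -[X in _ --> X]addr0 -(scale0r v).
by apply: cvgD; [exact: cvg_cst|apply: cvgZr_tmp; exact: cvg_id].
Qed.

Lemma sign_change (R : realType) (f : plane R -> R) (x v : plane R) :
  differentiable f x -> f x = 0 -> 0 < 'D_v f x ->
  \forall h \near 0^'+, f (x + h *: v) > 0 /\ f (x - h *: v) < 0.
Proof.
move=> df fx0 Dv.
have /cvg_ex[l Hl] : derivable f x v by exact: diff_derivable.
have Dl : 'D_v f x = l by exact: cvg_lim Hl.
rewrite Dl in Dv.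
have : \forall h \near (0 : R), h != 0 -> 0 < h^-1 *: (f (h *: v + x) - f x).
  exact: (cvgr_gt _ Hl _ Dv).
move=> /nbhs_ballP[e /= e0 He].
near=> h.
have h0 : 0 < h by near: h; exact: nbhs_right_gt.
have he : h < e by near: h; exact: nbhs_right_lt.
split.
  have : 0 < h^-1 *: (f (h *: v + x) - f x).
    by apply: (He h); rewrite ?gt_eqF// /ball/= sub0r normrN gtr0_norm.
  by rewrite fx0 subr0 pmulr_rgt0 ?invr_gt0// addrC.
have : 0 < (- h)^-1 *: (f ((- h) *: v + x) - f x).
  by apply: (He (- h)); rewrite ?oppr_eq0 ?gt_eqF// /ball/= sub0r opprK gtr0_norm.
by rewrite fx0 subr0 nmulr_rgt0 ?invr_lt0 ?oppr_lt0// scaleNr addrC.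
Unshelve. all: by end_near. Qed.

(** * Functions of class calF *)

Lemma calF_differentiable (R : realType) (D : set (plane R)) g x :
  calF D g -> D x -> differentiable g x.
Proof. by move=> [[_ [dg _ _] _] _ _ _]; exact: dg. Qed.

Lemma calF_cvg_within (R : realType) (D : set (plane R)) g x :
  calF D g -> closure D x -> g y @[y --> within (closure D) (nbhs x)] --> g x.
Proof. by move=> [[+ _ _] _ _ _] clx => /subspace_continuousP; exact. Qed.

Lemma calF_zero_grad (R : realType) (D : set (plane R)) g x :
  calF D g -> zeroset D g x -> 0 < grad_norm g x.
Proof. by move=> [_ + _ _] [Dx gx0] => /(_ _ Dx); rewrite gx0 normr0 addr0. Qed.

(** A point of the closure outside the open set [D] lies on its boundary, where
    [g] is positive. *)
Lemma calF_nonpos_in (R : realType) (D : set (plane R)) g x : open D ->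
  calF D g -> closure D x -> g x <= 0 -> D x.
Proof.
move=> oD [_ _ bg _] clx gx; apply: contrapT => nDx.
have : 0 < g x by apply: bg; split=> // /interior_subset.
by rewrite ltNge gx.
Qed.

(** At a zero of [g] the gradient is nonzero, so [g] takes negative values
    arbitrarily close to it; hence the zero is a limit of the sublevel set.
    Conversely, by continuity a boundary point cannot have [g] positive or
    negative, and a nonpositive value excludes the boundary of [D]. *)
Lemma zeroset_bdry (R : realType) (D : set (plane R)) g : open D -> calF D g ->
  bdry (sublevel D g) = zeroset D g.
Proof.
move=> oD Fg; apply/seteqP; split=> x.
  move=> [clx nix].
  have clDx : closure D x by apply: closure_subset clx => y [].
  have gx : g x <= 0.
    rewrite leNgt; apply/negP => gx.
    have gt0 : \forall y \near x, closure D y -> 0 < g y.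
      exact: (cvgr_gt _ (calF_cvg_within _ _ _ _ Fg clDx) _ gx).
    have [y [[Dy gy] /(_ (subset_closure Dy))]] := clx _ gt0.
    by rewrite /= ltNge (ltW gy).
  have Dx := calF_nonpos_in _ _ _ _ oD Fg clDx gx.
  split=> //; apply/eqP; rewrite eq_le gx /= leNgt; apply/negP => gxlt.
  have cg := differentiable_continuous (calF_differentiable _ _ _ _ Fg Dx).
  apply: nix; exact: filterI (open_nbhs_nbhs (conj oD Dx)) (cvgr_lt _ cg _ gxlt).
move=> Zx; have [Dx gx] := Zx.
have dg := calF_differentiable _ _ _ _ Fg Dx.
have [v Dv] := ascent_direction _ _ _ dg (calF_zero_grad _ _ _ _ Fg Zx).
split; last by move=> /interior_subset[_]; rewrite gx ltxx.
move=> U Ux.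
have UDx : nbhs x (U `&` D) by exact: filterI Ux (open_nbhs_nbhs (conj oD Dx)).
have near0 : \forall h \near (0 : R), (U `&` D) (x - h *: v).
  suff : \forall h \near (0 : R), (U `&` D) (x + h *: - v).
    by apply: filterS => h; rewrite scalerN.
  exact: (line_cvg _ x (- v) _ UDx).
have [h [[_ gh] [Uh Dh]]] : exists h, (g (x + h *: v) > 0 /\ g (x - h *: v) < 0) /\ (U `&` D) (x - h *: v).
  apply: (@filter_ex _ (0 : R)^'+); apply: filterI; first exact: sign_change.
  exact: (cvg_within _ near0).
by exists (x - h *: v).
Qed.

(** The zero of [g] is found on the segment from [x - h *: v] to [x + h *: v],
    with [v] an ascent direction of [gs]: any [r] smaller than the absolute
    values of [gs] at the two ends preserves their signs. The bound on [r] does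
    not depend on [g], as the compactness argument requires. *)
Lemma zero_persists (R : realType) (D : set (plane R)) gs x (U : set (plane R)) :
  open D -> calF D gs -> zeroset D gs x -> nbhs x U ->
  \forall r \near 0^'+, forall g : plane R -> R, {in D, continuous g} ->
    (forall y, D y -> `|g y - gs y| <= r) -> exists2 z, U z & zeroset D g z.
Proof.
move=> oD Fg Zx Ux; have [Dx gx] := Zx.
have dg := calF_differentiable _ _ _ _ Fg Dx.
have [v Dv] := ascent_direction _ _ _ dg (calF_zero_grad _ _ _ _ Fg Zx).
have UDx : nbhs x (U `&` D) by exact: filterI Ux (open_nbhs_nbhs (conj oD Dx)).
have /nbhs_ballP[e /= e0 He] := line_cvg _ x v _ UDx.
have [h [[gp gm] [h0 he]]] : exists h, (gs (x + h *: v) > 0 /\ gs (x - h *: v) < 0) /\ (0 < h /\ h < e).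
  apply: (@filter_ex _ (0 : R)^'+); apply: filterI; first exact: sign_change.
  by apply: filterI; [exact: nbhs_right_gt|exact: nbhs_right_lt].
have seg t : `|t| <= h -> U (x + t *: v) /\ D (x + t *: v).
  by move=> th; apply: He; rewrite /ball/= sub0r normrN (le_lt_trans th).
near=> r => g cg ggs.
have rp : r < gs (x + h *: v) by near: r; exact: nbhs_right_lt.
have rm : r < - gs (x - h *: v) by near: r; apply: nbhs_right_lt; rewrite oppr_gt0.
have [_ Dp] : U (x + h *: v) /\ D (x + h *: v) by apply: seg; rewrite gtr0_norm.
have [_ Dm] : U (x - h *: v) /\ D (x - h *: v).
  by rewrite -scaleNr; apply: seg; rewrite normrN gtr0_norm.
have gp0 : 0 < g (x + h *: v).
  by have := ggs _ Dp; rewrite ler_norml => /andP[]; lra.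
have gm0 : g (x - h *: v) < 0.
  by have := ggs _ Dm; rewrite ler_norml => /andP[]; lra.
have [t + gt] : exists2 t, t \in `[- h, h] & g (x + t *: v) = 0.
  apply: (@IVT _ (fun t => g (x + t *: v))).
  - by rewrite ge0_cp// ltW.
  - apply: continuous_in_subspaceT => t /set_mem/=.
    rewrite in_itv/= -ler_norml => /seg[_ Dt].
    apply: (@continuous_comp _ _ _ (fun t : R => x + t *: v) g); last by apply: cg; rewrite inE.
    by apply: cvgD; [exact: cvg_cst|apply: cvgZr_tmp; exact: cvg_id].
  - by rewrite scaleNr ge_min le_max (ltW gm0) (ltW gp0) orbT.
rewrite in_itv/= -ler_norml => /seg[Ut Dt].
by exists (x + t *: v).
Unshelve. all: by end_near. Qed.

(** * Uniform estimates by compactness *)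

(** Locally, [x] itself is the required zero when [gs x = 0]; otherwise
    [`|gs|] stays above [`|gs x| / 2] near [x], and the premise fails for
    smaller [r]. *)
Lemma almost_zero_near_zeroset (R : realType) (D : set (plane R)) gs (e : R) :
  open D -> compact (closure D) -> calF D gs -> 0 < e ->
  \forall r \near 0^'+, forall x, closure D x -> `|gs x| <= r ->
    exists2 z, zeroset D gs z & enorm (x - z) <= e.
Proof.
move=> oD cD Fgs e0.
have /compact_near_coveringP/near_covering_withinP := cD.
apply => x clx.
have [gx|gx] := eqVneq (gs x) 0.
  have Dx : D x by apply: (calF_nonpos_in _ _ gs) => //; rewrite gx.
  near=> y r => /= _ _; exists x => //.
  by apply/ltW; near: y; exact: enorm_near.
have cg : gs y @[y --> within (closure D) (nbhs x)] --> gs x.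
  exact: calF_cvg_within.
have gx0 : 0 < `|gs x| / 2 by rewrite divr_gt0 ?normr_gt0.
have gx2 : `|gs x| / 2 < `|gs x| by lra.
near=> y r => /= cly gr; exfalso.
have : `|gs x| / 2 < `|gs y|.
  by move: cly; near: y; exact: (cvgr_gt _ (cvg_norm cg)).
apply/negP; rewrite -leNgt; apply: le_trans gr _; apply: ltW.
by near: r; exact: nbhs_right_lt.
Unshelve. all: by end_near. Qed.

(** [zero_persists] made uniform in the zero. The covering argument runs over
    the compact closure of [D]: points where [gs] is nonzero have a
    neighbourhood free of zeros and contribute nothing. *)
Lemma zeroset_near_perturbed_zeroset (R : realType) (D : set (plane R)) gs (e : R) :
  open D -> compact (closure D) -> calF D gs -> 0 < e ->
  \forall r \near 0^'+, forall x, closure D x -> zeroset D gs x ->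
    forall g : plane R -> R, {in D, continuous g} ->
    (forall y, D y -> `|g y - gs y| <= r) ->
    exists2 z, zeroset D g z & enorm (x - z) <= e.
Proof.
move=> oD cD Fgs e0.
have /compact_near_coveringP/near_covering_withinP := cD.
apply => x clx.
have [gx|gx] := eqVneq (gs x) 0; last first.
  have cg : gs y @[y --> within (closure D) (nbhs x)] --> gs x.
    exact: calF_cvg_within.
  near=> y r => /= cly [_ gy]; exfalso.
  have : gs y != 0 by move: cly; near: y; exact: (cvgr_neq0 _ cg).
  by rewrite gy eqxx.
have Dx : D x by apply: (calF_nonpos_in _ _ gs) => //; rewrite gx.
(* The zero of [g] close to [x] must serve all [y] near [x]: both are kept in
   neighbourhoods of [x] whose points are mutually within distance [e]. *)
have [[V W] /= [Vx Wx] VW] : nbhs (x, x) [set q : plane R * plane R | enorm (q.1 - q.2) < e].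
  have c : q.1 - q.2 @[q --> (x, x)] --> (0 : plane R).
    by rewrite -(subrr x); apply: cvgB; [exact: cvg_fst|exact: cvg_snd].
  exact: (c _ (enorm_near0 _ _ e0)).
near=> y r => /= _ _ g cg ggs.
have [z Wz Zz] : exists2 z, W z & zeroset D g z.
  move: g cg ggs; near: r.
  by apply: (zero_persists _ _ gs x).
exists z => //; apply/ltW; apply: (VW (y, z)); split => //=.
by near: y.
Unshelve. all: by end_near. Qed.

Theorem theorem4p3 (R : realType) (D E : set (plane R)) (p : R)
    (f : plane R -> R) (beta : R -> R) (J : set (plane R) -> H10 D -> R)
    (Oms : set (plane R))
    (domD : domain D) (bndD : bounded_set D)
    (domE : domain E) (E_in_D : compactly_included E D)
    (p_gt2 : 2 < p) (f_Lp : f \_ D \in Lfun (area R) p%:E)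
    (beta_mono : {homo beta : x y / x <= y})
    (beta_lip : lipschitz_on_bounded beta)
    (beta_dirdiff : directionally_differentiable beta)
    (Oms_adm : calO_E D E Oms)
    (Oms_opt : locally_optimal E f beta J Oms) :
  forall gs : plane R -> R, calF_E D E gs -> sublevel D gs = Oms ->
  exists2 r : R, 0 < r &
    forall g : plane R -> R, calF_E D E g ->
      (C1_norm D (g \- gs)%R <= r%:E)%E ->
      calO D (sublevel D g) ->
      (forall Cs, component (zeroset D gs) Cs -> zeroset D g `&` Cs !=set0) ->
      (forall C, component (zeroset D g) C -> zeroset D gs `&` C !=set0) ->
      j_fun f beta J gs <= j_fun f beta J g.
Proof.
have [oD _ D0] := domD.
have cD := bounded_closure_compact _ _ bndD.
move=> gs [Fgs gsE] gsOms; have [rho rho0 opt] := Oms_opt.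
have [r [r0 [near_gs near_g]]] := filter_ex (filterI (nbhs_right_gt 0)
  (filterI (almost_zero_near_zeroset _ _ _ _ oD cD Fgs rho0)
           (zeroset_near_perturbed_zeroset _ _ _ _ oD cD Fgs rho0))).
exists r => // g [Fg gE] ggs Og _ _.
have sup_ggs x : closure D x -> `|g x - gs x| <= r by exact: C1_norm_ub D0 ggs.
rewrite /j_fun gsOms; apply: opt.
  have [cE EsubD] := E_in_D.
  by split=> //; split=> // x Ex; split; [exact: EsubD|exact: gE].
rewrite -gsOms !zeroset_bdry//; apply: hausdorff_dist_le => x Zx.
  apply: near_g => //; first by case: Zx => /subset_closure.
    move=> y; rewrite inE => Dy.
    exact: differentiable_continuous (calF_differentiable _ _ _ _ Fg Dy).
  by move=> y /subset_closure; exact: sup_ggs.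
have [/subset_closure Dx gx] := Zx.
by apply: near_gs => //; have := sup_ggs _ Dx; rewrite gx sub0r normrN.
Qed.
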